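(* For every $\varepsilon>0$ and all functions $g,h:\mathbb N\to\mathbb N$ there is a positive integer $N\leq\Phi(2\varepsilon/5,g,h)$ such that $$\max\left\{\|S_mT^mx-S_nT^kx\|,\ \|T^lS_nT^nx-S_nT^nx\|,\ \|T^lS_nT^kx-S_nT^kx\|\right\}<\varepsilon$$ for all $m,n\in[N,N+g(N)]$ and all $k,l\leq h(N)$.
   Context: Conventions: $\mathbb N=\{0,1,2,\dots\}$; for $m,n\in\mathbb N$, $[m,n]$ denotes the set of natural numbers $k$ with $m\le k\le n$; sums and maxima of functions are pointwise; $\operatorname{Id}(n)=n$; for $g:\mathbb N\to\mathbb N$ put $g^M(n):=\max_{m\le n}g(m)$. Setting: $X$ is a uniformly convex real Banach space, $C\subseteq X$ is non-empty, closed and convex, $b>0$ satisfies $\|y\|\le b/2$ for all $y\in C$, and $T:C\to C$ is nonexpansive ($\|Ty-Tz\|\le\|y-z\|$ for all $y,z\in C$) and has a fixed point. For $n\ge1$ and $y\in C$, $S_ny:=\frac1n\sum_{i=0}^{n-1}T^iy$; thus $S_nT^kx=\frac1n\sum_{i=0}^{n-1}T^{k+i}x$. Modulus of convexity: $\eta:[0,\infty)\to[0,\infty)$ is a given continuous function such that $\|\frac{u+v}2\|\le1-\eta(\varepsilon)$ whenever $\varepsilon>0$, $u,v\in X$, $\|u\|,\|v\|\le1$, $\|u-v\|\ge\varepsilon$, and such that $0<s<t$ implies $0=\eta(0)<\eta(s)<\eta(t)$ and $\eta(s)/s\le\eta(t)/t$. Constants $c,q$: $X^2$ carries the norm $\|(u,v)\|_2=(\|u\|^2+\|v\|^2)^{1/2}$,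 and $c>0$, $q>1$ are given such that $\mathbb E(\|\sum_{i=1}^nZ_i\|_2^q)\le c^q\sum_{i=1}^n\mathbb E(\|Z_i\|_2^q)$ for all $n$ and all independent (Bochner integrable) mean-zero random variables $Z_1,\dots,Z_n$ with values in $X^2$. Function $\gamma$: for $t\ge0$ let $\gamma_2(t)=\min\{t,\frac b2\eta(\frac{4t}b)\}$ and $\gamma_{n+1}(t)=\min\{\gamma_n(t),\gamma_2(\gamma_n(t/2)/3)\}$ for $n\ge2$. Let $\gamma(0)=0$ and, for $t>0$, $\gamma(t)=\gamma_{p(t)}(t/3)$ with $p(t)=\max\{2,\lceil(\frac{6bc}{\sqrt2\,t})^{q/(q-1)}\rceil\}$. Rate $A$: a point $x\in C$ is fixed, $\alpha^i_n:=\|T^nx-T^{n+i}x\|$, and a map $(\varepsilon,g,h)\mapsto A(\varepsilon,g,h)\in\mathbb N$ is given such that for all $\varepsilon>0$ and $g,h:\mathbb N\to\mathbb N$ there is $N\le A(\varepsilon,g,h)$ with $|\alpha^i_m-\alpha^i_n|<\varepsilon$ for all $m,n\in[N,N+g(N)]$ and $i\le h(N)$. Derived maps, for $\varepsilon>0$ and $g,h:\mathbb N\to\mathbb N$: (1) $B(\varepsilon,g,h):=A(\gamma(\varepsilon),\hat g,\hat h)$ with $\hat g(N)=N+2g(N)+h(N)$ and $\hat h(N)=2(N+g(N))$. (2) $g_\varepsilon(n):=n'+g^M(n')$ with $n'=\max\{n,\lceil 4nb/\varepsilon\rceil\}$; $g_\varepsilon^{(0)}(n)=\max\{1,n\}$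 and $g_\varepsilon^{(i+1)}(n)=g_\varepsilon(g_\varepsilon^{(i)}(n))$; and, with $K=\lceil 2b/\varepsilon\rceil$, $$\Theta^B(\varepsilon,g,h):=g_\varepsilon^{(K+1)}\left(B\left(\tfrac\varepsilon4,\,g_\varepsilon^{(K+2)},\,\max\{2\cdot g_\varepsilon^{(K+1)},\,h^M\circ g_\varepsilon^{(K+1)}\}\right)\right).$$ (3) $\delta(\varepsilon):=\min\{b,\frac\varepsilon4,\frac\varepsilon8\,\eta(\frac\varepsilon{2b})\}$, $g'_\varepsilon(n):=\lceil\frac{6b(n+g(n))}{\delta(\varepsilon)}\rceil$, and $\Delta^B(\varepsilon,g,h):=\Theta^B(\delta(\varepsilon),\,g+g'_\varepsilon,\,\max\{\operatorname{Id}+g+2g'_\varepsilon,\,h\})$. (4) $\Psi(\varepsilon,g,h):=\Delta^B(\frac\varepsilon4,g''_{\varepsilon,h},h)$ with $g''_{\varepsilon,h}(N):=\max\{g(N),\lceil\frac{4b\,h(N)}\varepsilon\rceil\}$. (5) $N_\varepsilon(n):=\max\{n,\lceil\frac{6nb}\varepsilon\rceil\}$ and $\Phi(\varepsilon,g,h):=N_\varepsilon(\Psi(\frac\varepsilon2,g',h'))$ with $g'(n):=N_\varepsilon(n)+g(N_\varepsilon(n))$ and $h'(n):=g'(n)+h(N_\varepsilon(n))$. *)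

(* Defs.v *)
From mathcomp Require Import all_boot all_order all_algebra.
From mathcomp Require Import all_classical all_reals all_analysis.

Set Implicit Arguments.
Unset Strict Implicit.
Unset Printing Implicit Defensive.

Import Order.TTheory GRing.Theory Num.Theory.
Import numFieldNormedType.Exports.

Local Open Scope classical_set_scope.
Local Open Scope ring_scope.

Definition uniformly_convex (R : realType) (X : normedModType R) : Prop :=
  forall eps : R, 0 < eps -> exists2 delta : R, 0 < delta &
    forall u v : X, `|u| <= 1 -> `|v| <= 1 -> eps <= `|u - v| ->
      `|2^-1 *: (u + v)| <= 1 - delta.

(* [eta] stands for a function from [0, +oo[ to [0, +oo[; its values at
   negative arguments are irrelevant. *)
Definition convexity_modulus (R : realType) (X : normedModType R)
    (eta : R -> R) : Prop :=
  [/\ forall t, 0 <= t -> 0 <= eta t,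
      {within `[0, +oo[, continuous eta},
      forall (eps : R) (u v : X), 0 < eps -> `|u| <= 1 -> `|v| <= 1 ->
        eps <= `|u - v| -> `|2^-1 *: (u + v)| <= 1 - eta eps &
      forall s t : R, 0 < s -> s < t ->
        [/\ eta 0 = 0, eta 0 < eta s, eta s < eta t &
            eta s / s <= eta t / t]].

Section Bochner.
Context {d : measure_display} {Omega : measurableType d} {R : realType}.
Context (P : probability Omega R) {V : normedModType R}.

Definition simple_rv (s : Omega -> V) : Prop :=
  finite_set (range s) /\ forall v, measurable (s @^-1` [set v]).

Definition simple_mean (s : Omega -> V) : V :=
  \sum_(v \in [set: V]) fine (P (s @^-1` [set v])) *: v.

Definition strongly_measurable (Z : Omega -> V) : Prop :=
  exists2 s : nat -> Omega -> V, (forall k, simple_rv (s k)) &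
    forall w, s k w @[k --> \oo] --> Z w.

Definition L1_approx (s : nat -> Omega -> V) (Z : Omega -> V) : Prop :=
  (forall k, simple_rv (s k)) /\
  (\int[P]_w (`|Z w - s k w|%:E))%E @[k --> \oo] --> 0%E.

Definition bochner_integrable (Z : Omega -> V) : Prop :=
  strongly_measurable Z /\ exists s, L1_approx s Z.

Definition has_bochner_mean (Z : Omega -> V) (m : V) : Prop :=
  exists2 s, L1_approx s Z & simple_mean (s k) @[k --> \oo] --> m.

(* Letting some of the [B i] be the whole space gives the product rule for
   subfamilies. *)
Definition independent_rvs (n : nat) (Z : 'I_n -> Omega -> V) : Prop :=
  forall B : 'I_n -> set V, (forall i, <<s @open V >> (B i)) ->
    P (\bigcap_(i in [set: 'I_n]) (Z i @^-1` B i))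
      = (\prod_(i < n) P (Z i @^-1` B i))%E.

End Bochner.

(* The library norm on [X * X] is the max norm. It is equivalent to this one,
   so Borel sets, strong measurability, Bochner integrability and the Bochner
   integral on [X * X] may be taken with respect to either. *)
Definition norm2 (R : realType) (X : normedModType R) (z : X * X) : R :=
  Num.sqrt (`|z.1| ^+ 2 + `|z.2| ^+ 2).

Definition type_inequality (R : realType) (X : normedModType R)
    (c q : R) : Prop :=
  forall (d : measure_display) (Omega : measurableType d)
         (P : probability Omega R) (n : nat) (Z : 'I_n -> Omega -> X * X),
    (forall i, bochner_integrable P (Z i)) ->
    (forall i, has_bochner_mean P (Z i) 0) ->
    independent_rvs P Z ->
    ('E_P[fun w => (norm2 (\sum_(i < n) Z i w) `^ q)%R]
      <= (c `^ q)%:E * \sum_(i < n) 'E_P[fun w => (norm2 (Z i w) `^ q)%R])%E.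

(* Only used at nonnegative arguments. *)
Definition ceilN (R : realType) (x : R) : nat := `|Num.ceil x|%N.

Definition maxf (g : nat -> nat) (n : nat) : nat := (\max_(m < n.+1) g m)%N.

Definition ergodic_mean (R : realType) (X : normedModType R) (T : X -> X)
    (n : nat) (y : X) : X :=
  n%:R^-1 *: \sum_(i < n) iter i T y.

Definition gamma2 (R : realType) (b : R) (eta : R -> R) (t : R) : R :=
  Num.min t (b / 2 * eta (4 * t / b)).

(* [gamma_seq b eta k] is gamma_{k+2} *)
Fixpoint gamma_seq (R : realType) (b : R) (eta : R -> R) (k : nat) (t : R)
    {struct k} : R :=
  if k is j.+1 then
    Num.min (gamma_seq b eta j t) (gamma2 b eta (gamma_seq b eta j (t / 2) / 3))
  else gamma2 b eta t.

Definition gamma_index (R : realType) (b c q : R) (t : R) : nat :=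
  maxn 2 (ceilN ((6 * b * c / (Num.sqrt 2 * t)) `^ (q / (q - 1)))).

Definition gamma (R : realType) (b c q : R) (eta : R -> R) (t : R) : R :=
  if t == 0 then 0
  else gamma_seq b eta (gamma_index b c q t - 2) (t / 3).

Definition functional (R : realType) : Type :=
  R -> (nat -> nat) -> (nat -> nat) -> nat.

Definition metastability_rate (R : realType) (X : normedModType R)
    (T : X -> X) (x : X) (A : functional R) : Prop :=
  let alpha i n := `|iter n T x - iter (n + i) T x| in
  forall (eps : R) (g h : nat -> nat), 0 < eps ->
    exists2 N : nat, (N <= A eps g h)%N &
      forall m n i : nat, (N <= m <= N + g N)%N -> (N <= n <= N + g N)%N ->
        (i <= h N)%N -> `|alpha i m - alpha i n| < eps.

Definition B_of (R : realType) (b c q : R) (eta : R -> R) (A : functional R) :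
    functional R := fun eps g h =>
  A (gamma b c q eta eps)
    (fun N => N + 2 * g N + h N)%N
    (fun N => 2 * (N + g N))%N.

Definition g_step (R : realType) (b eps : R) (g : nat -> nat) (n : nat) : nat :=
  let n' := maxn n (ceilN (4 * n%:R * b / eps)) in (n' + maxf g n')%N.

Definition g_iter (R : realType) (b eps : R) (g : nat -> nat) (i n : nat) :
    nat :=
  iter i (g_step b eps g) (maxn 1 n).

Definition Theta (R : realType) (b : R) (B : functional R) : functional R :=
  fun eps g h =>
  let K := ceilN (2 * b / eps) in
  g_iter b eps g (K + 1)
    (B (eps / 4) (g_iter b eps g (K + 2))
       (fun n => maxn (2 * g_iter b eps g (K + 1) n)
                      (maxf h (g_iter b eps g (K + 1) n)))).

Definition delta_of (R : realType) (b : R) (eta : R -> R) (eps : R) : R :=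
  Num.min b (Num.min (eps / 4) (eps / 8 * eta (eps / (2 * b)))).

Definition Delta (R : realType) (b : R) (eta : R -> R) (B : functional R) :
    functional R := fun eps g h =>
  let delta := delta_of b eta eps in
  let g' n := ceilN (6 * b * (n + g n)%:R / delta) in
  Theta b B delta (fun n => g n + g' n)%N
    (fun n => maxn (n + g n + 2 * g' n) (h n)).

Definition Psi (R : realType) (b : R) (eta : R -> R) (B : functional R) :
    functional R := fun eps g h =>
  Delta b eta B (eps / 4)
    (fun N => maxn (g N) (ceilN (4 * b * (h N)%:R / eps))) h.

Definition N_of (R : realType) (b eps : R) (n : nat) : nat :=
  maxn n (ceilN (6 * n%:R * b / eps)).

Definition Phi (R : realType) (b : R) (eta : R -> R) (B : functional R) :
    functional R := fun eps g h =>
  let g' n := (N_of b eps n + g (N_of b eps n))%N in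
  let h' n := (g' n + h (N_of b eps n))%N in
  N_of b eps (Psi b eta B (eps / 2) g' h').

(* Main.v *)
(* If T^l almost preserves the distances between finitely many points of C, then
   it is almost affine on them.  For two points this is uniform convexity applied
   to the quotients of the distances of T^l x, T^l y, T^l z (z between x and y);
   n points follow by induction, with a modulus gamma_n; and the dependence on n
   is removed by Maurey's sampling argument, the type inequality on X^2 giving a
   mean of p(t) of the pairs (x_i, T^l x_i) within t/3 of the weighted mean.
   Since the numbers |T^n x - T^(n+i) x| are metastable, the powers of T are
   therefore almost affine on late orbit points.  Then, for a fixed point f:
   - S_n T^n x is almost an average of the points T^l S_m T^m x when n is much
     larger than m, so |S_n T^n x - f| is almost decreasing, hence metastable;
   - the same applied to the midpoint of S_m T^m x and S_n T^n x shows by uniform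
     convexity that these two points are close;
   - S_n T^k x, for n large and any k, is an average of points T^l S_m T^m x,
     each of which is close to S_m T^m x. *)

Require Import Defs.
From HB Require Import structures.
From mathcomp Require Import all_boot all_order all_algebra.
From mathcomp Require Import all_classical all_reals all_analysis.
From mathcomp Require Import ring lra zify.

Set Implicit Arguments.
Unset Strict Implicit.
Unset Printing Implicit Defensive.

Import Order.TTheory GRing.Theory Num.Theory.
Import numFieldNormedType.Exports.

Local Open Scope classical_set_scope.
Local Open Scope ring_scope.

(* MathComp's lemma [Num.Theory.ceilN] shadows the function of Defs. *)
Local Notation ceilN := Defs.ceilN.

(** * Finite convex combinations *)

Section ConvexCombinations.
Context {R : realType} {X : normedModType R}.
Implicit Types (C : set X) (I : finType).

Definition convex_weights I (w : I -> R) : Prop :=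
  (forall i, 0 <= w i) /\ \sum_i w i = 1.

Lemma convex_set_combine C x y (l : R) : convex_set C -> 0 <= l <= 1 ->
  C x -> C y -> C (l *: x + (1 - l) *: y).
Proof.
move=> Cconv /andP[l0 l1] Cx Cy.
have := Cconv x y (Itv01 l0 l1).
by rewrite !inE; exact.
Qed.

Lemma convex_set_sum C I (w : I -> R) (y : I -> X) : convex_set C ->
  convex_weights w -> (forall i, C (y i)) -> C (\sum_i w i *: y i).
Proof.
move=> Cconv [w0 w1] Cy.
(* Normalising needs a positive partial weight, so the induction carries the degenerate case of
   weight 0 as an alternative. *)
suff H (s : seq I) : (\sum_(i <- s) w i = 0 /\ \sum_(i <- s) w i *: y i = 0) \/
    0 < \sum_(i <- s) w i /\
    C ((\sum_(i <- s) w i)^-1 *: \sum_(i <- s) w i *: y i).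
  have [[]|[_]] := H (index_enum I); first by rewrite w1 => /eqP; rewrite oner_eq0.
  by rewrite w1 invr1 scale1r.
elim: s => [|a s IH]; first by left; rewrite !big_nil.
rewrite !big_cons; case: IH => [[-> ->]|[s0 Cs]].
  rewrite !addr0; have := w0 a; rewrite le_eqVlt => /predU1P[<-|wa].
    by left; rewrite scale0r.
  by right; split => //; rewrite scalerA mulVf ?scale1r// gt_eqF.
right; set W := \sum_(j <- s) w j in s0 Cs *; have wW : 0 < w a + W by rewrite ltr_wpDl.
split => //; have := @convex_set_combine C (y a) _ (w a / (w a + W)) Cconv _ (Cy a) Cs.
have -> : 1 - w a / (w a + W) = W / (w a + W).
  by rewrite -[X in X - _](divff (lt0r_neq0 wW)) -mulrBl [_ + W]addrC addrK.
rewrite scalerA mulrAC divff ?gt_eqF// mul1r scalerDr scalerA [_^-1 * w a]mulrC.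
apply; rewrite divr_ge0 ?(ltW wW)//=.
by rewrite ler_pdivrMr// mul1r lerDl ltW.
Qed.

Lemma convex_sum_norm_le I (w : I -> R) (y : I -> X) (r : R) :
  convex_weights w -> (forall i, `|y i| <= r) -> `|\sum_i w i *: y i| <= r.
Proof.
move=> [w0 w1] yr; apply: le_trans (ler_norm_sum _ _ _) _.
rewrite -[leRHS]mul1r -w1 mulr_suml ler_sum// => i _.
by rewrite normrZ ger0_norm// ler_wpM2l.
Qed.

Lemma convex_sum_sub I (w : I -> R) (y : I -> X) (z : X) :
  convex_weights w -> \sum_i w i *: y i - z = \sum_i w i *: (y i - z).
Proof.
move=> [_ w1]; under [RHS]eq_bigr do rewrite scalerBr.
by rewrite sumrB -scaler_suml w1 scale1r.
Qed.


End ConvexCombinations.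

(** * Uniform convexity and the affinity defect of a nonexpansive map *)

Section BruckInequality.
Context {R : realType} {X : normedModType R}.
Context (C : set X) (C_convex : convex_set C).
Context (b : R) (b_gt0 : 0 < b) (C_bounded : forall y, C y -> `|y| <= b / 2).
Context (eta : R -> R) (eta_mod : convexity_modulus X eta).

Lemma bounded_dist (y z : X) : C y -> C z -> `|y - z| <= b.
Proof.
move=> /C_bounded yb /C_bounded zb; apply: le_trans (ler_normB _ _) _.
by rewrite [leRHS]splitr lerD.
Qed.

Lemma eta0 : eta 0 = 0.
Proof. by case: eta_mod => _ _ _ /(_ 1 2); case; rewrite ?ltr1n. Qed.

Lemma eta_mono (s t : R) : 0 <= s -> s < t -> eta s < eta t.
Proof.
case: eta_mod => _ _ _ E; rewrite le_eqVlt => /predU1P[<- t0|s0 st].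
  by case: (E t (t + 1) t0); rewrite ?ltrDl.
by case: (E s t s0 st).
Qed.

Lemma eta_le (s t : R) : 0 <= s -> s <= t -> eta s <= eta t.
Proof.
by move=> s0; rewrite le_eqVlt => /predU1P[->//|st]; rewrite ltW ?eta_mono.
Qed.

Lemma eta_ge0 (t : R) : 0 <= t -> 0 <= eta t.
Proof. by case: eta_mod => + _ _ _; exact. Qed.

(* s |-> eta s / s is nondecreasing, read along s = w / k. *)
Lemma eta_perspective (w k k' : R) : 0 <= w -> 0 < k -> k <= k' ->
  k' * eta (w / k') <= k * eta (w / k).
Proof.
move=> w0 k0; rewrite le_eqVlt => /predU1P[->//|kk'].
have k'0 : 0 < k' by exact: lt_trans kk'.
move: w0; rewrite le_eqVlt => /predU1P[<-|w0]; first by rewrite !mul0r eta0 !mulr0.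
have [||_ _ _] := (let: And4 _ _ _ E := eta_mod in E) (w / k') (w / k).
- by rewrite divr_gt0.
- by rewrite ltr_pM2l// ltf_pV2.
rewrite !invf_div => H.
have := ler_wpM2l (ltW w0) H.
have E (y : R) : w * (eta (w / y) * (y / w)) = y * eta (w / y).
  by rewrite mulrCA [w * (y / w)]mulrCA divff ?gt_eqF// mulr1 mulrC.
by rewrite !E.
Qed.

(** By symmetry l <= 1 - l; the point is then 2 l times the midpoint plus (1 - 2 l) v, and only the
    midpoint gains. This yields 1 - 2 l eta, which is below the symmetric form. *)
Lemma modulus_combine (u v : X) (l : R) : 0 <= l <= 1 -> `|u| <= 1 -> `|v| <= 1 ->
  `|l *: u + (1 - l) *: v| <= 1 - 2 * (l * (1 - l)) * eta `|u - v|.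
Proof.
wlog lh : u v l / l <= 1 - l.
  move=> W l01 u1 v1; have [|lh] := leP l (1 - l); first by move=> lh; exact: W.
  have := W v u (1 - l); have -> : 1 - (1 - l) = l by ring.
  rewrite [l *: u + _]addrC [l * _]mulrC distrC; apply=> //; first exact: ltW.
  by lra.
move=> /andP[l0 l1] u1 v1; set e := `|u - v|.
have half : `|2^-1 *: (u + v)| <= 1 - eta e.
  have [e0|e0] := ltP 0 e; first by case: eta_mod => _ _ H _; exact: H.
  have -> : e = 0 by apply/eqP; rewrite eq_le e0 normr_ge0.
  rewrite eta0 subr0 normrZ gtr0_norm ?invr_gt0 ?ltr0n//.
  by rewrite ler_pdivrMl ?ltr0n// mulr1 (le_trans (ler_normD _ _))// mulr2n lerD.
have -> : l *: u + (1 - l) *: v = (2 * l) *: (2^-1 *: (u + v)) + (1 - 2 * l) *: v.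
  rewrite scalerA mulrC mulrA mulVf ?pnatr_eq0// mul1r scalerDr -addrA -scalerDl.
  by congr (_ + _ *: _); ring.
have ee : 0 <= eta e by exact/eta_ge0/normr_ge0.
apply: le_trans (ler_normD _ _) _.
have A : `|(2 * l) *: (2^-1 *: (u + v))| <= 2 * l * (1 - eta e).
  by rewrite normrZ ger0_norm ?ler_wpM2l// mulr_ge0.
have B : `|(1 - 2 * l) *: v| <= 1 - 2 * l.
  have l2 : 0 <= 1 - 2 * l by lra.
  by rewrite normrZ ger0_norm// ler_piMr.
apply: le_trans (lerD A B) _.
have : 0 <= l * l * eta e by rewrite !mulr_ge0.
nra.
Qed.

Lemma gamma2_mono (s t : R) : 0 <= s -> s < t -> gamma2 b eta s < gamma2 b eta t.
Proof.
move=> s0 st; rewrite /gamma2 lt_min !gt_min st /=.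
apply/orP; right; rewrite ltr_pM2l ?divr_gt0 ?ltr0n//; apply: eta_mono.
  by rewrite divr_ge0 ?mulr_ge0 ?(ltW b_gt0).
by rewrite ltr_pM2r ?invr_gt0// ltr_pM2l ?ltr0n.
Qed.

(** Strict monotonicity stands in for an inverse of [gamma2]: a bound on [gamma2] of a defect
    becomes a bound on the defect. *)
Lemma gamma2_le_inv (s t : R) : 0 <= t -> gamma2 b eta s <= gamma2 b eta t -> s <= t.
Proof. by move=> t0; apply: contraTT; rewrite -!ltNge => /(gamma2_mono t0). Qed.

Lemma gamma2_le_id (t : R) : gamma2 b eta t <= t.
Proof. by rewrite /gamma2 ge_min lexx. Qed.

Lemma gamma2_0 : gamma2 b eta 0 = 0.
Proof. by rewrite /gamma2 mulr0 mul0r eta0 mulr0 minxx. Qed.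

Lemma gamma2_gt0 (t : R) : 0 < t -> 0 < gamma2 b eta t.
Proof. by move=> t0; rewrite -gamma2_0 gamma2_mono. Qed.

Lemma gamma_seq_gt0 k (t : R) : 0 < t -> 0 < gamma_seq b eta k t.
Proof.
elim: k t => [|k IH] t t0 /=; first exact: gamma2_gt0.
by rewrite lt_min IH//= gamma2_gt0// divr_gt0 ?ltr0n// IH// divr_gt0 ?ltr0n.
Qed.

Lemma gamma_seq_le_gamma2 k (t : R) : gamma_seq b eta k t <= gamma2 b eta t.
Proof.
by elim: k => [|k IH]; [exact: lexx|rewrite /= ge_min IH].
Qed.

Context (T : X -> X) (T_C : forall y, C y -> C (T y)).
Context (T_nonexp : forall y z, C y -> C z -> `|T y - T z| <= `|y - z|).

(** With z the combination and d = |x - y|, the difference quotients of T between y and z and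
    between z and x lie in the unit ball. Combined with weights l and 1 - l they give (T x - T y) /
    d, and they differ by the defect over l (1 - l) d, so a large defect forces |T x - T y| well
    below d. The cases l = 0, l = 1 and d = 0, where a quotient is undefined, come first. *)
Lemma gamma2_defect (x y : X) (l : R) : 0 <= l <= 1 -> C x -> C y ->
  gamma2 b eta `|T (l *: x + (1 - l) *: y) - (l *: T x + (1 - l) *: T y)|
    <= `|x - y| - `|T x - T y|.
Proof.
move=> /andP[l0 l1] Cx Cy; set z := l *: x + _.
have Cz : C z by apply: convex_set_combine => //; rewrite l0.
have d'd := T_nonexp Cx Cy.
move: l0; rewrite le_eqVlt => /predU1P[l0|l0].
  have -> : z = y by rewrite /z -l0 scale0r add0r subr0 scale1r.
  by rewrite -l0 scale0r add0r subr0 scale1r subrr normr0 gamma2_0 subr_ge0.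
move: l1; rewrite le_eqVlt => /predU1P[l1|l1].
  have -> : z = x by rewrite /z l1 subrr scale0r addr0 scale1r.
  by rewrite l1 subrr scale0r addr0 scale1r subrr normr0 gamma2_0 subr_ge0.
have zy : z - y = l *: (x - y).
  by rewrite /z scalerBl scale1r scalerBr addrCA addrC addrK.
have zx : x - z = (1 - l) *: (x - y).
  by rewrite /z opprD addrA -[X in X - _ - _]scale1r -scalerBl -scalerBr.
have l'0 : 0 < 1 - l by rewrite subr_gt0.
set d := `|x - y|.
have [d0|d0] := leP d 0.
  have xy : x = y by apply/eqP; rewrite -subr_eq0 -normr_le0.
  rewrite /z xy -!scalerDl addrCA subrr addr0 !scale1r subrr normr0 gamma2_0.
  by rewrite /d xy !subrr normr0.
set w := `|_ - _|.
pose u := (l * d)^-1 *: (T z - T y); pose v := ((1 - l) * d)^-1 *: (T x - T z).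
have ld : 0 < l * d by rewrite mulr_gt0.
have l'd : 0 < (1 - l) * d by rewrite mulr_gt0.
have u1 : `|u| <= 1.
  rewrite normrZ gtr0_norm ?invr_gt0// ler_pdivrMl// mulr1 (le_trans (T_nonexp Cz Cy))//.
  by rewrite zy normrZ gtr0_norm.
have v1 : `|v| <= 1.
  rewrite normrZ gtr0_norm ?invr_gt0// ler_pdivrMl// mulr1 (le_trans (T_nonexp Cx Cz))//.
  by rewrite zx normrZ gtr0_norm.
have := @modulus_combine u v l _ u1 v1; rewrite (ltW l0) (ltW l1) => /(_ isT).
have -> : l *: u + (1 - l) *: v = d^-1 *: (T x - T y).
  rewrite !scalerA !invfM !mulrA !divff ?gt_eqF// !mul1r -scalerDr.
  by rewrite addrC addrA subrK.
have -> : `|u - v| = w / (l * (1 - l) * d).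
  have -> : u - v = (l * (1 - l) * d)^-1 *: (T z - (l *: T x + (1 - l) *: T y)).
    rewrite /u /v.
    have -> : (l * d)^-1 = (l * (1 - l) * d)^-1 * (1 - l) by field; rewrite !gt_eqF.
    have -> : ((1 - l) * d)^-1 = (l * (1 - l) * d)^-1 * l by field; rewrite !gt_eqF.
    rewrite -!scalerA -scalerBr; congr (_ *: _).
    rewrite !scalerBr opprB [LHS]addrC addrA [X in X - _]addrC.
    rewrite -addrA opprD !addrA; congr (_ - _).
    by rewrite -scalerDl subrK scale1r.
  by rewrite normrZ gtr0_norm ?invr_gt0 ?mulr_gt0// mulrC.
rewrite normrZ gtr0_norm ?invr_gt0// ler_pdivrMl// => H.
(* [eta_perspective] trades l (1 - l) d for its upper bound b / 4, which removes l and d and leaves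
   the second term of [gamma2]. *)
have kb : l * (1 - l) * d <= b / 4.
  have -> : b / 4 = 4^-1 * b by rewrite mulrC.
  apply: ler_pM; rewrite ?mulr_ge0 ?(ltW l0) ?(ltW l'0) ?(ltW d0)//.
    by have := sqr_ge0 (l - 2^-1); rewrite expr2; lra.
  exact: bounded_dist.
have := @eta_perspective w _ _ (normr_ge0 _) (mulr_gt0 (mulr_gt0 l0 l'0) d0) kb.
set kk := l * (1 - l) * d * _ => kk1.
have E : d * (1 - 2 * (l * (1 - l)) * eta (w / (l * (1 - l) * d))) = d - 2 * kk.
  by rewrite /kk; ring.
rewrite E in H.
rewrite /gamma2 ge_min; apply/orP; right.
have -> : 4 * w / b = w / (b / 4) by field; rewrite gt_eqF.
lra.
Qed.

(* With l the weight of the first point z and mu_i = w_i / (1 - l), the combination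
   becomes that of the points l z + (1 - l) y_i with weights mu_i. *)
Lemma gamma_seq_defect k (w : 'I_k.+2 -> R) (y : 'I_k.+2 -> X) (t : R) :
  0 < t -> convex_weights w -> (forall i, C (y i)) ->
  (forall i j, `|y i - y j| - `|T (y i) - T (y j)| <= gamma_seq b eta k t) ->
  `|T (\sum_i w i *: y i) - \sum_i w i *: T (y i)| <= t.
Proof.
elim: k w y t => [|k IH] w y t t0 [w0 w1] Cy /= dy.
  move: w1; rewrite !big_ord_recl !big_ord0 !addr0 => w1.
  have -> : w (lift ord0 ord0) = 1 - w ord0 by rewrite -w1 [_ + w _]addrC addrK.
  apply: gamma2_le_inv (ltW t0) _.
  apply: le_trans (dy ord0 (lift ord0 ord0)); apply: gamma2_defect => //.
  by rewrite w0/= -w1 lerDl.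
have w10 : \sum_(i < k.+2) w (lift ord0 i) = 1 - w ord0.
  by rewrite -w1 [in RHS]big_ord_recl [w ord0 + _]addrC addrK.
set l := w ord0 in w10; set z := y ord0.
have l0 : 0 <= l by exact: w0.
have l1 : l <= 1 by rewrite -subr_ge0 -w10 sumr_ge0.
(* For l = 1 the rescaled weights [mu] would divide by 0; all other weights then vanish and both
   sums reduce to their first term. *)
have [{}l1|l1'] := eqVneq l 1.
  have wz i : w (lift ord0 i) = 0.
    apply/eqP; have /eqP := w10; rewrite l1 subrr psumr_eq0// => /allP /(_ i).
    by rewrite mem_index_enum => /(_ isT).
  have sum1 (F : 'I_k.+3 -> X) : \sum_i w i *: F i = F ord0.
    rewrite big_ord_recl -/l l1 scale1r big1 ?addr0// => i _.
    by rewrite wz scale0r.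
  by rewrite !sum1 subrr normr0 ltW.
have l'0 : 0 < 1 - l by rewrite subr_gt0 lt_neqAle l1'.
pose mu i := (1 - l)^-1 * w (lift ord0 i).
have mu_w : convex_weights mu.
  split=> [i|]; first by rewrite mulr_ge0// invr_ge0 ltW.
  by rewrite -mulr_sumr w10 mulVf// gt_eqF.
pose u i := l *: z + (1 - l) *: y (lift ord0 i).
pose u' i := l *: T z + (1 - l) *: T (y (lift ord0 i)).
have sumE (F : 'I_k.+3 -> X) :
    \sum_i w i *: F i = \sum_i mu i *: (l *: F ord0 + (1 - l) *: F (lift ord0 i)).
  rewrite big_ord_recl; under [in RHS]eq_bigr do rewrite scalerDr.
  rewrite big_split/= -scaler_suml mu_w.2 scale1r; congr (_ + _).
  apply: eq_bigr => i _; rewrite scalerA /mu mulrAC mulVf ?mul1r//.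
  by rewrite gt_eqF.
have l01 : 0 <= l <= 1 by rewrite l0.
have Cu i : C (u i) by exact: (convex_set_combine C_convex l01 (Cy _) (Cy _)).
set s := gamma_seq b eta k (t / 2) in dy.
have t20 : 0 < t / 2 by rewrite divr_gt0.
have s0 : 0 < s by exact: gamma_seq_gt0.
have st : s <= t / 2.
  exact: le_trans (gamma_seq_le_gamma2 _ _) (gamma2_le_id _).
have dy' i j : `|y i - y j| - `|T (y i) - T (y j)| <= gamma2 b eta (s / 3).
  by apply: le_trans (dy i j) _; rewrite ge_min lexx orbT.
have Tu i : `|T (u i) - u' i| <= s / 3.
  apply: gamma2_le_inv; first by rewrite divr_ge0// ltW.
  exact: le_trans (gamma2_defect l01 (Cy _) (Cy _)) (dy' _ _).
(* The distance of u_i and u_j shrinks by at most s under T: s / 3 from the pair y_i, y_j and s / 3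
   for each replacement of T u_i by u'_i. A last replacement costs s / 3 <= t / 6, within the
   remaining t / 2. *)
have H : `|T (\sum_i mu i *: u i) - \sum_i mu i *: T (u i)| <= t / 2.
  apply: IH => // i j.
  have E (v v' : X) (a : X) : l *: a + (1 - l) *: v - (l *: a + (1 - l) *: v') =
      (1 - l) *: (v - v').
    by rewrite opprD addrACA subrr add0r -scalerBr.
  have A : `|u i - u j| - `|u' i - u' j| <= s / 3.
    rewrite /u /u' !E !normrZ (gtr0_norm l'0) -mulrBr.
    have D := dy' (lift ord0 i) (lift ord0 j).
    apply: le_trans (gamma2_le_id (s / 3)); apply: le_trans D.
    rewrite ler_piMl//; last by lra.
    by rewrite subr_ge0 T_nonexp.
  have B : `|u' i - u' j| <= s / 3 + `|T (u i) - T (u j)| + s / 3.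
    have -> : u' i - u' j = (u' i - T (u i)) + (T (u i) - T (u j)) + (T (u j) - u' j).
      by rewrite [u' i - _ + _]addrA subrK addrA subrK.
    apply: le_trans (ler_normD _ _) _; apply: lerD => //.
    apply: le_trans (ler_normD _ _) _; apply: lerD => //.
    by rewrite distrC.
  by rewrite -/s; lra.
rewrite !sumE -/z.
have H' : `|\sum_i mu i *: T (u i) - \sum_i mu i *: u' i| <= s / 3.
  rewrite -sumrB; under eq_bigr do rewrite -scalerBr.
  exact: convex_sum_norm_le.
have := le_trans (ler_normD _ _) (lerD H H'); rewrite addrA subrK.
by move/le_trans; apply; lra.
Qed.

End BruckInequality.

(** * Finite probability laws and their Bochner means *)

Section FiniteSampleSpace.
Context {R : realType}.
Local Open Scope ereal_scope.

(** The law is carried to [nat], where every set is measurable, as a sum of weighted Dirac masses at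
    the indices of [enum F]; [dec] reads an index back, and its default [x0] occurs only on a null
    set. *)
Lemma exists_finite_law (F : finType) (x0 : F) (W : F -> R) :
  convex_weights W -> exists (P : probability nat R) (dec : nat -> F),
    forall A : set F, P (dec @^-1` A) = (\sum_(f | f \in A) W f)%:E.
Proof.
move=> [W0 W1]; pose dec n := nth x0 (enum F) n.
pose m k := mscale (NngNum (W0 (dec k))) (@dirac _ nat k R) : measure nat R.
pose mu := msum m #|F|.
have muE (A : set F) : mu (dec @^-1` A) = (\sum_(f | f \in A) W f)%:E.
  rewrite /mu /= /msum/= [in RHS]big_mkcond [in RHS](reindex (@enum_val F predT))/=; last first.
    by apply: onW_bij; exact: enum_val_bij.
  rewrite -sumEFin; apply: eq_bigr => i _.
  rewrite /m/= /mscale/= diracE /dec -(enum_val_nth x0 i).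
  have -> : ((i : nat) \in dec @^-1` A) = (enum_val i \in A).
    by apply/idP/idP; rewrite !inE /= /dec -(enum_val_nth x0 i).
  by case: ifP => _; rewrite ?mule1 ?mule0.
have muT : mu [set: nat] = 1.
  rewrite -(preimage_setT dec) muE -W1; congr (_%:E).
  by apply: eq_bigl => f; rewrite in_setT.
pose PM := Measure_isProbability.Build _ _ _ (msum m #|F|) muT.
pose P : probability nat R := HB.pack (msum m #|F|) PM.
by exists P, dec => A; exact: muE.
Qed.

Context {V : normedModType R} {F : finType} (W : F -> R).
Context (P : probability nat R) (dec : nat -> F).
Context (PE : forall A : set F, P (dec @^-1` A) = (\sum_(f | f \in A) W f)%:E).

Lemma finite_simple_rv (phi : F -> V) : simple_rv (phi \o dec).
Proof.
split=> [|v]; last by [].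
apply: (@sub_finite_set _ _ (phi @` [set: F])); last exact/finite_image/finite_finset.
by move=> _ [n _ <-]; exists (dec n).
Qed.

(** A variable with finitely many outcomes is already simple, so a constant sequence approximates
    it. *)
Lemma finite_L1_approx (phi : F -> V) :
  L1_approx P (fun=> phi \o dec) (phi \o dec).
Proof.
split=> [k|]; first exact: finite_simple_rv.
under eq_fun do under eq_integral do rewrite subrr normr0.
by rewrite integral0; exact: cvg_cst.
Qed.

Lemma finite_bochner_integrable (phi : F -> V) : bochner_integrable P (phi \o dec).
Proof.
split; last by exists (fun=> phi \o dec); exact: finite_L1_approx.
exists (fun=> phi \o dec) => [k|w]; first exact: finite_simple_rv.
exact: cvg_cst.
Qed.

(** [simple_mean] sums over values and the right side over outcomes; as [phi] may repeat a value,
    each value collects the weights of its fibre. *)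
Lemma finite_simple_mean (phi : F -> V) :
  simple_mean P (phi \o dec) = (\sum_f W f *: phi f)%R.
Proof.
pose s := undup [seq phi f | f <- enum F].
have fs f : phi f \in s by rewrite mem_undup; apply/map_f; rewrite mem_enum.
pose G v := (fine (P ((phi \o dec) @^-1` [set v])) *: v)%R.
have GE v : G v = (\sum_(f | phi f == v) W f *: phi f)%R.
  rewrite /G comp_preimage PE/= scaler_suml; apply: eq_big => f.
    by apply/idP/eqP; rewrite inE.
  by rewrite inE => /= ->.
rewrite /simple_mean -/G -(@fsbig_widen _ _ _ _ [set` s])//; last first.
  move=> v /= [_ vs]; rewrite -/(G v) GE big1// => f /eqP fv.
  by case: vs; rewrite -fv; exact: fs.
rewrite -fsbig_seq ?undup_uniq//.
under eq_bigr => v _ do rewrite -/(G v) GE big_mkcond.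
rewrite exchange_big/=; apply: eq_bigr => f _.
rewrite (bigD1_seq (phi f)) ?undup_uniq//= eqxx big1 ?addr0// => v.
by rewrite eq_sym => /negPf ->.
Qed.

Lemma finite_has_bochner_mean (phi : F -> V) :
  has_bochner_mean P (phi \o dec) (\sum_f W f *: phi f)%R.
Proof.
exists (fun=> phi \o dec); first exact: finite_L1_approx.
by rewrite finite_simple_mean; exact: cvg_cst.
Qed.

End FiniteSampleSpace.

(** * Independent samples from a weighted finite family *)

Section Sampling.
Context {R : realType} {X : normedModType R}.
Context (I : finType) (w : I -> R) (w_cvx : convex_weights w) (p : nat).

Definition product_weight (f : {ffun 'I_p -> I}) : R := \prod_i w (f i).

(** Expanding a product of sums: this one identity gives the total mass, the marginals and the
    independence of the coordinates. *)
Lemma sum_product_weight (G : 'I_p -> I -> R) :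
  \sum_f product_weight f * \prod_i G i (f i) = \prod_i \sum_k w k * G i k.
Proof.
by rewrite bigA_distr_bigA; apply: eq_bigr => f _; rewrite big_split.
Qed.

Lemma product_weight_convex : convex_weights product_weight.
Proof.
case: w_cvx => w0 w1; split=> [f|]; first exact: prodr_ge0.
transitivity (\sum_f product_weight f * \prod_(i < p) (1 : R)).
  by apply: eq_bigr => f _; rewrite big1// mulr1.
rewrite (sum_product_weight (fun _ _ => 1)) big1// => i _.
by apply: etrans w1; apply: eq_bigr => k _; rewrite mulr1.
Qed.

Lemma product_weight_marginal (i : 'I_p) (G : I -> R) :
  \sum_f product_weight f * G (f i) = \sum_k w k * G k.
Proof.
have := sum_product_weight (fun j k => if j == i then G k else 1).
rewrite [RHS](bigD1 i)//= eqxx [X in _ * X]big1 ?mulr1 => [<-|j /negPf ->]; last first.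
  by under eq_bigr => k _ do rewrite mulr1; exact: w_cvx.2.
apply: eq_bigr => f _; rewrite (bigD1 i)//= eqxx big1 ?mulr1// => j /negPf.
by move=> ->.
Qed.

(* An average over independent samples is as small as the type inequality
   predicts for its expectation, so some sample realises that bound. *)
Lemma exists_small_sample (c q r : R) (z : I -> X * X) :
  type_inequality X c q -> 0 <= q -> \sum_k w k *: z k = 0 ->
  (forall k, norm2 (z k) <= r) ->
  exists f : 'I_p -> I,
    norm2 (\sum_i z (f i)) `^ q <= c `^ q * (p%:R * r `^ q).
Proof.
move=> cq q0 z0 zr.
have [k0 _|none] := pickP (@predT I); last first.
  by have /eqP := w_cvx.2; rewrite big_pred0// eq_sym oner_eq0.
have [P [dec PE]] := exists_finite_law [ffun=> k0] product_weight_convex.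
pose Z i : nat -> X * X := (fun f : {ffun 'I_p -> I} => z (f i)) \o dec.
have meanZ i : has_bochner_mean P (Z i) 0.
  have := finite_has_bochner_mean PE (fun f => z (f i)).
  suff -> : \sum_f product_weight f *: z (f i) = 0 by [].
  apply: etrans z0.
  (* Samples are grouped by their i-th point k; the marginal of the indicator of k shows that such a
     group has weight [w k]. *)
  transitivity
    (\sum_k (\sum_(f : {ffun 'I_p -> I} | f i == k) product_weight f) *: z k).
    rewrite (partition_big (fun f : {ffun 'I_p -> I} => f i) predT)//=.
    apply: eq_bigr => k _; rewrite scaler_suml.
    by apply: eq_bigr => f /eqP ->.
  apply: eq_bigr => k _; congr (_ *: _).
  have <- : \sum_j w j * (j == k)%:R = w k.
    rewrite (bigD1 k)//= eqxx mulr1 big1 ?addr0// => j /negPf ->.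
    by rewrite mulr0.
  rewrite -(product_weight_marginal i (fun j => (j == k)%:R)).
  rewrite big_mkcond; apply: eq_bigr => f _.
  by case: eqP => _; rewrite ?mulr1 ?mulr0.
have indepZ : independent_rvs P Z.
  move=> B _.
  (* With indicators as factors, probabilities of events are sums that [sum_product_weight]
     factorises. *)
  pose G i k : R := (z k \in B i)%:R.
  have PZ i : P (Z i @^-1` B i) = (\sum_k w k * G i k)%:E.
    rewrite comp_preimage PE -(product_weight_marginal i (G i)) big_mkcond.
    congr (_%:E); apply: eq_bigr => f _.
    have -> : (f \in (fun g : {ffun 'I_p -> I} => z (g i)) @^-1` B i) = (z (f i) \in B i).
      by apply/idP/idP; rewrite !inE.
    by rewrite /G; case: (_ \in _); rewrite ?mulr1 ?mulr0.
  under [RHS]eq_bigr do rewrite PZ.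
  rewrite prodEFin -sum_product_weight.
  have -> : \bigcap_(i in [set: 'I_p]) (Z i @^-1` B i) =
      dec @^-1` [set f | forall i, B i (z (f i))].
    by apply/seteqP; split=> n /= H i; [exact: H|move=> _; exact: H].
  rewrite PE big_mkcond; congr (_%:E); apply: eq_bigr => f _.
  case: ifPn => [|/negP]; rewrite inE /= => H.
    rewrite big1 ?mulr1// => i _; rewrite /G.
    by have -> : z (f i) \in B i by rewrite inE.
  have [i Hi] : exists i, ~ B i (z (f i)) by exact/existsNP.
  rewrite (bigD1 i)//= /G.
  have -> : (z (f i) \in B i) = false by apply/negbTE/negP; rewrite inE.
  by rewrite mul0r mulr0.
have intZ i : bochner_integrable P (Z i) by exact: finite_bochner_integrable.
have := cq _ _ P p Z intZ meanZ indepZ.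
pose Phi (f : {ffun 'I_p -> I}) := norm2 (\sum_i z (f i)) `^ q.
(* The minimum over the finitely many samples is attained and lies below the expectation. *)
have [f _ fmin] := @arg_minP _ _ _ [ffun=> k0] predT Phi isT.
move=> H; exists f; rewrite -lee_fin.
have low : ((Phi f)%:E <= 'E_P[fun n => (norm2 (\sum_(i < p) Z i n) `^ q)%R])%E.
  rewrite -(expectation_cst P); apply: expectation_le => //.
  - by move=> n; exact: powR_ge0.
  - by move=> n; exact: powR_ge0.
  - by apply: aeW => n; exact: fmin.
apply: le_trans low _; apply: le_trans H _.
rewrite EFinM; apply: lee_wpmul2l; first by rewrite lee_fin powR_ge0.
have r0 : 0 <= r by apply: le_trans (zr k0); exact: sqrtr_ge0.
have -> : (p%:R * r `^ q)%:E = (\sum_(i < p) (r `^ q)%:E)%E.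
  by rewrite sumEFin sumr_const card_ord mulr_natl.
apply: lee_sum => i _; rewrite -(expectation_cst P); apply: expectation_le => //.
- by move=> n; exact: powR_ge0.
- by move=> n; exact: powR_ge0.
- by apply: aeW => n; apply: ge0_ler_powR; rewrite ?nnegrE//; [exact: sqrtr_ge0|exact: zr].
Qed.

End Sampling.

(** * Rounding and monotonicity of the bounds *)

Section CeilingBounds.
Context {R : realType}.

Lemma ceilN_ge (y : R) : y <= (ceilN y)%:R.
Proof.
rewrite /ceilN; apply: le_trans (ceil_ge y) _.
by rewrite natr_absz ler_int ler_norm.
Qed.

Lemma ceilN_le (y z : R) : 0 <= y -> y <= z -> (ceilN y <= ceilN z)%N.
Proof.
move=> y0 yz; have z0 : 0 <= z by exact: le_trans yz.
rewrite -lez_nat /ceilN !gez0_abs ?le_ceil//.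
  by rewrite ceil_ge0 (lt_le_trans _ z0)// ltrN10.
by rewrite ceil_ge0 (lt_le_trans _ y0)// ltrN10.
Qed.

Lemma div_ceilN_le (y d : R) (n : nat) : 0 < d -> (0 < n)%N ->
  (ceilN (y / d) <= n)%N -> y / n%:R <= d.
Proof.
move=> d0 n0 yn; rewrite ler_pdivrMr ?ltr0n// mulrC -ler_pdivrMr//.
by apply: le_trans (ceilN_ge _) _; rewrite ler_nat.
Qed.

Lemma leq_maxf (g : nat -> nat) (m n : nat) : (m <= n)%N -> (g m <= maxf g n)%N.
Proof.
move=> mn; rewrite -ltnS in mn.
exact: (@leq_bigmax _ (fun i : 'I_n.+1 => g i) (Ordinal mn)).
Qed.

Lemma maxf_mono (g : nat -> nat) (m n : nat) : (m <= n)%N -> (maxf g m <= maxf g n)%N.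
Proof.
move=> mn; apply/bigmax_leqP => i _; apply: leq_maxf.
by apply: leq_trans mn; rewrite -ltnS.
Qed.

Context (b : R) (b_gt0 : 0 < b).

Lemma g_step_mono (e : R) g (m n : nat) : 0 < e -> (m <= n)%N ->
  (g_step b e g m <= g_step b e g n)%N.
Proof.
move=> e0 mn; rewrite /g_step.
set m' := maxn m _; set n' := maxn n _.
suff mn' : (m' <= n')%N by rewrite leq_add// maxf_mono.
rewrite geq_max !leq_max mn/=; apply/orP; right; apply: ceilN_le.
  by rewrite divr_ge0 ?mulr_ge0// ltW.
by rewrite ler_wpM2r ?invr_ge0 ?(ltW e0)// ler_wpM2r ?(ltW b_gt0)// ler_wpM2l// ler_nat.
Qed.

(** The metastability argument starts from some N0 below the value of B; monotonicity carries its
    bound from N0 to that value. *)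
Lemma g_iter_mono (e : R) g i (m n : nat) : 0 < e -> (m <= n)%N ->
  (g_iter b e g i m <= g_iter b e g i n)%N.
Proof.
move=> e0 mn; rewrite /g_iter; elim: i => [|i IH] /=; last exact: g_step_mono.
by lia.
Qed.

Lemma N_of_mono (e : R) (m n : nat) : 0 < e -> (m <= n)%N ->
  (N_of b e m <= N_of b e n)%N.
Proof.
move=> e0 mn; rewrite /N_of geq_max !leq_max mn/=; apply/orP; right.
apply: ceilN_le; first by rewrite divr_ge0 ?mulr_ge0// ltW.
by rewrite ler_wpM2r ?invr_ge0 ?(ltW e0)// ler_wpM2r ?(ltW b_gt0)// ler_wpM2l// ler_nat.
Qed.

End CeilingBounds.

(** * A defect bound independent of the number of points *)

Section ConvexCombinationDefect.
Context {R : realType} {X : normedModType R}.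
Context (C : set X) (C_convex : convex_set C).
Context (b : R) (b_gt0 : 0 < b) (C_bounded : forall y, C y -> `|y| <= b / 2).
Context (eta : R -> R) (eta_mod : convexity_modulus X eta).
Context (c q : R) (c_gt0 : 0 < c) (q_gt1 : 1 < q) (cq_type : type_inequality X c q).

Lemma norm2_ge1 (z : X * X) : `|z.1| <= norm2 z.
Proof.
by rewrite -[leLHS]ger0_norm// -sqrtr_sqr ler_wsqrtr// lerDl sqr_ge0.
Qed.

Lemma norm2_ge2 (z : X * X) : `|z.2| <= norm2 z.
Proof.
by rewrite -[leLHS]ger0_norm// -sqrtr_sqr ler_wsqrtr// lerDr sqr_ge0.
Qed.

Lemma norm2_le (z : X * X) (r : R) : `|z.1| <= r -> `|z.2| <= r ->
  norm2 z <= Num.sqrt 2 * r.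
Proof.
move=> z1 z2; have r0 : 0 <= r by exact: le_trans z1.
rewrite -[r in leRHS]ger0_norm// -sqrtr_sqr -sqrtrM// ler_wsqrtr//.
by rewrite mulrDl mul1r lerD// lerXn2r ?nnegrE.
Qed.

Lemma sample_size_bound (v s M : R) (p : nat) : 0 <= v -> 0 < s -> 0 < M ->
  s `^ (q / (q - 1)) <= p%:R -> v `^ q <= p%:R * (s * M) `^ q -> v <= p%:R * M.
Proof.
move=> v0 s0 M0 sp vq; have q1 : 0 < q - 1 by rewrite subr_gt0.
have p0 : 0 < p%:R :> R by apply: lt_le_trans sp; rewrite powR_gt0.
have q0 : 0 < q by lra.
have sq : s `^ q <= p%:R `^ (q - 1).
  have -> : s `^ q = (s `^ (q / (q - 1))) `^ (q - 1).
    by rewrite -powRrM mulfVK// gt_eqF.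
  by apply: ge0_ler_powR; rewrite ?nnegrE ?powR_ge0 ?(ltW q1)// ltW.
have : v `^ q <= (p%:R * M) `^ q.
  apply: le_trans vq _.
  rewrite !powRM ?(ltW s0) ?(ltW p0) ?(ltW M0)// mulrA.
  apply: ler_wpM2r; first exact: powR_ge0.
  have -> : p%:R `^ q = p%:R * p%:R `^ (q - 1) :> R.
    rewrite -[X in X * _]powRr1 ?(ltW p0)// -powRD; last by rewrite (gt_eqF p0) implybT.
    by congr (_ `^ _); ring.
  by apply: ler_wpM2l sq; rewrite ltW.
apply: contraTT; rewrite -!ltNge => H.
by apply: gt0_ltr_powR; rewrite ?nnegrE// mulr_ge0// ltW.
Qed.

Lemma gamma_gt0 (t : R) : 0 < t -> 0 < gamma b c q eta t.
Proof.
move=> t0; rewrite /gamma gt_eqF//; apply: (gamma_seq_gt0 b_gt0 eta_mod).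
by rewrite divr_gt0.
Qed.

Context (T : X -> X) (T_C : forall y, C y -> C (T y)).
Context (T_nonexp : forall y z, C y -> C z -> `|T y - T z| <= `|y - z|).

(** Three errors of t / 3: from T m to T of the sample mean, by nonexpansiveness; the defect at the
    p(t) sampled points; and from the mean of their images to m'. *)
Lemma gamma_defect (I : finType) (w : I -> R) (y : I -> X) (t : R) : 0 < t ->
  convex_weights w -> (forall i, C (y i)) ->
  (forall i j, `|y i - y j| - `|T (y i) - T (y j)| <= gamma b c q eta t) ->
  `|T (\sum_i w i *: y i) - \sum_i w i *: T (y i)| <= t.
Proof.
move=> t0 w_cvx Cy; rewrite /gamma (gt_eqF t0) => dy.
set p := gamma_index b c q t in dy.
have p2 : (2 <= p)%N by exact: leq_maxl.
have p0 : 0 < p%:R :> R by rewrite ltr0n ltnW.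
set m := \sum_i w i *: y i; set m' := \sum_i w i *: T (y i).
have Cm : C m by exact: convex_set_sum.
have Cm' : C m' by apply: convex_set_sum => // i; exact: T_C.
(* Centring gives mean 0, and working in X^2 lets a single sample approximate both means. *)
pose z i := (y i - m, T (y i) - m').
have z0 : \sum_i w i *: z i = 0.
  have z1 : (\sum_i w i *: z i).1 = 0.
    by rewrite (raddf_sum fst)/= -convex_sum_sub// subrr.
  have z2 : (\sum_i w i *: z i).2 = 0.
    by rewrite (raddf_sum snd)/= -convex_sum_sub// subrr.
  by rewrite [LHS]surjective_pairing z1 z2.
have zb i : norm2 (z i) <= Num.sqrt 2 * b.
  by apply: norm2_le; apply: (bounded_dist C_bounded) => //; exact: T_C.
have [f fq] := exists_small_sample w_cvx p cq_type (ltW (lt_trans ltr01 q_gt1)) z0 zb.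
have s20 : 0 < Num.sqrt 2 :> R by rewrite sqrtr_gt0.
have fM : norm2 (\sum_i z (f i)) <= p%:R * (t / 3).
  apply: (@sample_size_bound _ (6 * b * c / (Num.sqrt 2 * t))).
  - exact: sqrtr_ge0.
  - by rewrite divr_gt0// ?mulr_gt0.
  - by rewrite divr_gt0.
  - apply: le_trans (ceilN_ge _) _; rewrite ler_nat; exact: leq_maxr.
  - apply: le_trans fq _.
    (* The base of the power in p(t) is chosen so that, times t / 3, it equals c times the bound
       sqrt 2 b on the pairs. *)
    have -> : 6 * b * c / (Num.sqrt 2 * t) * (t / 3) = c * (Num.sqrt 2 * b).
      have E : Num.sqrt 2 * Num.sqrt 2 = 2 :> R by rewrite -expr2 sqr_sqrtr.
      have -> : 6 * b * c = 3 * (Num.sqrt 2 * Num.sqrt 2) * b * c by rewrite E; ring.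
      by field; rewrite !gt_eqF.
    rewrite powRM ?(ltW c_gt0)//; last by rewrite mulr_ge0// ltW.
    by rewrite mulrCA.
pose u := fun _ : 'I_p => p%:R^-1 : R.
have u_cvx : convex_weights u.
  split=> [i|]; first by rewrite invr_ge0 ltW.
  by rewrite sumr_const card_ord -[_ *+ _]mulr_natl divff// gt_eqF.
have avg (v : X) (F : 'I_p -> X) : `|\sum_i (F i - v)| <= p%:R * (t / 3) ->
    `|\sum_i u i *: F i - v| <= t / 3.
  move=> H; rewrite convex_sum_sub// -scaler_sumr normrZ gtr0_norm ?invr_gt0//.
  by rewrite ler_pdivrMl.
have A1 : `|\sum_i u i *: y (f i) - m| <= t / 3.
  apply: avg; apply: le_trans fM; apply: le_trans (norm2_ge1 _).
  by rewrite (raddf_sum fst).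
have A2 : `|\sum_i u i *: T (y (f i)) - m'| <= t / 3.
  apply: avg; apply: le_trans fM; apply: le_trans (norm2_ge2 _).
  by rewrite (raddf_sum snd).
have A3 : `|T (\sum_i u i *: y (f i)) - \sum_i u i *: T (y (f i))| <= t / 3.
  (* [gamma_seq] counts from 2 and p >= 2, so p is destructed as k + 2. *)
  move: u u_cvx {avg A1 A2 fM fq} f dy; clearbody p.
  case: p p2 p0 => [|[|k]]// _ _ u u_cvx f dy.
  apply: (gamma_seq_defect C_convex b_gt0 C_bounded eta_mod T_nonexp) => //.
    by rewrite divr_gt0.
  by move=> i j; apply: le_trans (dy _ _) _; rewrite subn2.
have A4 : `|T m - T (\sum_i u i *: y (f i))| <= t / 3.
  apply: le_trans A1; rewrite distrC; apply: T_nonexp => //.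
  exact: convex_set_sum.
have -> : t = t / 3 + (t / 3 + t / 3) by field.
apply: le_trans (ler_distD (T (\sum_i u i *: y (f i))) _ _) _; apply: lerD => //.
apply: le_trans (ler_distD (\sum_i u i *: T (y (f i))) _ _) _; exact: lerD.
Qed.

End ConvexCombinationDefect.

(** * Powers of T that are almost affine on the orbit *)

Section AlmostAffine.
Context {R : realType} {X : normedModType R} (T : X -> X) (x : X).

Definition orbit_mean (n k : nat) : X := ergodic_mean T n (iter k T x).

Definition uniform_weight (n : nat) (_ : 'I_n) : R := n%:R^-1.

Lemma uniform_weight_convex n : (0 < n)%N -> convex_weights (@uniform_weight n).
Proof.
move=> n0; split=> [i|]; first by rewrite invr_ge0.
rewrite sumr_const card_ord -[_ *+ _]mulr_natl divff//.
by rewrite pnatr_eq0 -lt0n.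
Qed.

Lemma orbit_meanE n k :
  orbit_mean n k = \sum_(i < n) uniform_weight i *: iter (k + i) T x.
Proof.
rewrite /orbit_mean /ergodic_mean scaler_sumr; apply: eq_bigr => i _.
by rewrite -iterD addnC.
Qed.

(** The window for [p i] extends to 2 (N + G) because S_n T^n x with N <= n <= N + G averages the
    T^j x with n <= j < 2 n. *)
Definition almost_affine (e : R) (N G H : nat) : Prop :=
  forall (I : finType) (w : I -> R) (p : I -> nat) (l : nat),
    convex_weights w -> (forall i, (N <= p i <= 2 * (N + G))%N) -> (l <= H)%N ->
    `|iter l T (\sum_i w i *: iter (p i) T x) - \sum_i w i *: iter (p i + l) T x|
      <= e.

Lemma almost_affine_sub e N G H N' G' H' : almost_affine e N G H ->
  (N <= N')%N -> (N' + G' <= N + G)%N -> (H' <= H)%N -> almost_affine e N' G' H'.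
Proof.
move=> aff NN' GG' HH' I w p l w_cvx pr lH; apply: aff => //; last exact: leq_trans HH'.
by move=> i; have := pr i; lia.
Qed.

Lemma almost_affine_orbit_mean e N G H n l : almost_affine e N G H ->
  (0 < n)%N -> (N <= n <= N + G)%N -> (l <= H)%N ->
  `|iter l T (orbit_mean n n) - orbit_mean n (n + l)| <= e.
Proof.
move=> aff n0 nr lH; rewrite !orbit_meanE.
under [X in _ - X]eq_bigr do rewrite addnAC.
apply: aff => //; first exact: uniform_weight_convex.
by move=> i; have := ltn_ord i; lia.
Qed.

End AlmostAffine.

(** * Ergodic means along the orbit *)

Section Orbit.
Context {R : realType} {X : normedModType R}.
Context (C : set X) (C_convex : convex_set C).
Context (b : R) (b_gt0 : 0 < b) (C_bounded : forall y, C y -> `|y| <= b / 2).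
Context (T : X -> X) (T_C : forall y, C y -> C (T y)).
Context (T_nonexp : forall y z, C y -> C z -> `|T y - T z| <= `|y - z|).
Context (x : X) (Cx : C x).

Local Notation orbit_mean := (orbit_mean T x).
Local Notation almost_affine := (almost_affine T x).

Lemma iter_stable n y : C y -> C (iter n T y).
Proof. by move=> Cy; elim: n => //= n; exact: T_C. Qed.

Lemma iter_nonexp n y z : C y -> C z -> `|iter n T y - iter n T z| <= `|y - z|.
Proof.
move=> Cy Cz; elim: n => //= n; apply: le_trans.
by apply: T_nonexp; exact: iter_stable.
Qed.

Lemma orbit_mean_C n k : (0 < n)%N -> C (orbit_mean n k).
Proof.
move=> n0; rewrite orbit_meanE; apply: convex_set_sum => //.
  exact: uniform_weight_convex.
by move=> i; exact: iter_stable.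
Qed.

(** By telescoping, a shift by one exchanges a single end term of the average and costs at most b /
    n. *)
Lemma orbit_mean_shift n k s : (0 < n)%N ->
  `|orbit_mean n (k + s) - orbit_mean n k| <= s%:R * b / n%:R.
Proof.
move=> n0; elim: s => [|s IH]; first by rewrite addn0 subrr normr0 !mul0r.
apply: le_trans (ler_distD (orbit_mean n (k + s)) _ _) _.
rewrite -natr1 mulrDl mulrDl mul1r [leRHS]addrC; apply: lerD => //.
rewrite !orbit_meanE /uniform_weight -!scaler_sumr -scalerBr normrZ.
rewrite ger0_norm ?invr_ge0// mulrC ler_wpM2r ?invr_ge0//.
have -> : \sum_(i < n) iter (k + s.+1 + i) T x - \sum_(i < n) iter (k + s + i) T x
    = iter (k + s + n) T x - iter (k + s) T x.
  have := @telescope_sumr _ 0 n (fun i => iter (k + s + i) T x) isT.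
  rewrite addn0 => <-; rewrite big_mkord sumrB; congr (_ - _).
  by apply: eq_bigr => i _; rewrite addnS addSnnS.
by apply: (bounded_dist C_bounded); exact: iter_stable.
Qed.

Lemma orbit_mean_dist n k k' d : (0 < n)%N -> (k <= k' + d)%N -> (k' <= k + d)%N ->
  `|orbit_mean n k - orbit_mean n k'| <= d%:R * b / n%:R.
Proof.
move=> n0; wlog kk' : k k' / (k' <= k)%N.
  move=> W; have [/W|/ltnW /W] := leqP k' k; first exact.
  by rewrite distrC => H h1 h2; exact: H.
move=> kd _; rewrite -(subnKC kk'); apply: le_trans (orbit_mean_shift _ _ n0) _.
rewrite ler_wpM2r ?invr_ge0// ler_wpM2r ?(ltW b_gt0)// ler_nat.
by rewrite leq_subLR.
Qed.

(* Averaging T^l U = sum_i w_i T^(p_i + l) x + O(e) over a window of M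
   consecutive l and exchanging the two averages gives a convex combination of
   means of length M, all starting near K. *)
Lemma orbit_mean_near (I : finType) (w : I -> R) (p : I -> nat) e N G H k M K D v r :
  let U := \sum_i w i *: iter (p i) T x in
  almost_affine e N G H -> convex_weights w -> (0 < M)%N ->
  (forall i, (N <= p i <= 2 * (N + G))%N) -> (k + M <= H.+1)%N ->
  (forall i, (p i + k <= K + D)%N) -> (forall i, (K <= p i + k + D)%N) ->
  (forall l, (k <= l < k + M)%N -> `|iter l T U - v| <= r) ->
  `|orbit_mean M K - v| <= r + e + D%:R * b / M%:R.
Proof.
move=> U aff w_cvx M0 pr kM pK Kp Ur.
pose L l := \sum_i w i *: iter (p i + l) T x.
pose AL := \sum_(i < M) uniform_weight i *: L (k + i)%N.
have ALE : AL = \sum_j w j *: orbit_mean M (p j + k).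
  rewrite /AL /L; under eq_bigr do rewrite scaler_sumr.
  rewrite exchange_big/=; apply: eq_bigr => j _.
  rewrite orbit_meanE scaler_sumr; apply: eq_bigr => i _.
  by rewrite !scalerA mulrC addnA.
have A1 : `|orbit_mean M K - AL| <= D%:R * b / M%:R.
  rewrite distrC ALE convex_sum_sub//; apply: convex_sum_norm_le => // i.
  exact: orbit_mean_dist.
have uM := uniform_weight_convex M0.
have A2 : `|AL - v| <= r + e.
  rewrite /AL convex_sum_sub//; apply: convex_sum_norm_le => // i.
  have iM := ltn_ord i.
  apply: le_trans (ler_distD (iter (k + i) T U) _ _) _; rewrite addrC; apply: lerD.
    by apply: Ur; rewrite leq_addr ltn_add2l.
  by rewrite distrC; apply: aff => //; lia.
apply: le_trans (ler_distD AL _ _) _; rewrite addrC; exact: lerD.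
Qed.

End Orbit.


(** * Metastability of the ergodic means *)

Section Metastability.
Context {R : realType} {X : normedModType R}.
Context (C : set X) (C_convex : convex_set C).
Context (b : R) (b_gt0 : 0 < b) (C_bounded : forall y, C y -> `|y| <= b / 2).
Context (eta : R -> R) (eta_mod : convexity_modulus X eta).
Context (c q : R) (c_gt0 : 0 < c) (q_gt1 : 1 < q) (cq_type : type_inequality X c q).
Context (T : X -> X) (T_C : forall y, C y -> C (T y)).
Context (T_nonexp : forall y z, C y -> C z -> `|T y - T z| <= `|y - z|).
Context (f : X) (Cf : C f) (Tf : T f = f).
Context (x : X) (Cx : C x).
Context (A : functional R) (A_rate : metastability_rate T x A).

Local Notation S := (orbit_mean T x).
Local Notation almost_affine := (almost_affine T x).
Local Notation B := (B_of b c q eta A).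

(** For p_i <= p_j, the defect of the pair under T^l is the change of alpha^(p_j - p_i) between p_i
    and p_i + l. Here p_i + l <= 2 (N + g N) + h N and p_j - p_i <= 2 (N + g N), which are the two
    ranges handed to A. *)
Lemma B_of_almost_affine (e : R) (g h : nat -> nat) : 0 < e ->
  exists2 N, (N <= B e g h)%N & almost_affine e N (g N) (h N).
Proof.
move=> e0; have ge0 : 0 < gamma b c q eta e by exact: (gamma_gt0 b_gt0 eta_mod).
have [N NA AN] := A_rate (fun N => N + 2 * g N + h N)%N (fun N => 2 * (N + g N))%N ge0.
exists N => // I w p l w_cvx pr lh.
under [X in _ - X]eq_bigr do rewrite addnC iterD.
have TC l' := iter_stable T_C l'.
apply: (gamma_defect C_convex b_gt0 C_bounded eta_mod c_gt0 q_gt1 cq_type (TC l)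
  (iter_nonexp T_C T_nonexp l) e0 w_cvx) => [i|i j]; first exact: TC.
wlog pij : i j / (p i <= p j)%N.
  move=> W; have [/W//|/ltnW /W] := leqP (p i) (p j).
  by rewrite distrC [X in _ - X]distrC.
rewrite -!iterD -(subnKC pij) ![(l + _)%N]addnC addnAC.
apply: le_trans (ler_norm _) _; apply: ltW; apply: AN.
- by have := pr i; lia.
- by have := pr i; lia.
- by have := pr j; have := pr i; lia.
Qed.

Lemma iter_fixpoint n : iter n T f = f.
Proof. by elim: n => //= n ->. Qed.

(** If each of the stages 0, ..., K contains a drop of e, while passing to the next stage regains at
    most e / 2, the distance to f sinks by e / 2 per stage. Starting at most at b, it would become
    negative at stage K >= 2 b / e. *)
Lemma theta_metastable (e : R) (g h : nat -> nat) : 0 < e ->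
  exists N, [/\ (0 < N)%N, (N <= Theta b B e g h)%N,
    almost_affine (e / 4) N (g N) (h N) &
    forall m n, (N <= m <= N + g N)%N -> (N <= n <= N + g N)%N ->
      `| `|S m m - f| - `|S n n - f| | < e].
Proof.
move=> e0; rewrite /Theta; set K := ceilN _.
set G := fun n => g_iter b e g (K + 2) n.
set H := fun n => maxn _ _.
have e40 : 0 < e / 4 by rewrite divr_gt0.
have [N0 N0B aff] := B_of_almost_affine G H e40.
pose s i := g_iter b e g i N0.
(* The gap from s_i to s'_i makes j b / n <= e / 4 for all j <= s_i and n >= s'_i. *)
pose s' i := maxn (s i) (ceilN (4 * (s i)%:R * b / e)).
have sS i : s i.+1 = (s' i + maxf g (s' i))%N by [].
have ss' i : (s i <= s' i)%N by exact: leq_maxl.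
have s'sS i : (s' i + g (s' i) <= s i.+1)%N by rewrite sS leq_add2l leq_maxf.
have s_le i j : (i <= j)%N -> (s i <= s j)%N.
  move=> ij; rewrite -(subnKC ij); elim: (j - i)%N => [|k IH]; first by rewrite addn0.
  by rewrite addnS; have := ss' (i + k)%N; have := s'sS (i + k)%N; lia.
have s0 i : (0 < s i)%N by apply: leq_trans (s_le 0%N i (leq0n i)); exact: leq_maxl.
have sN i : (N0 <= s i)%N by apply: leq_trans (s_le 0%N i (leq0n i)); exact: leq_maxr.
pose a n := `|S n n - f|.
have GS : G N0 = s K.+2 by rewrite /G addn2.
have HS : H N0 = maxn (2 * s K.+1) (maxf h (s K.+1)) by rewrite /H addn1.
have sK12 : (s K.+1 <= s K.+2)%N by exact: s_le.
(* S_n T^n x is almost an average of the T^l S_j T^j x, l from n - j on, none farther from f than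
   S_j T^j x; the starting points n + i with i < j lie within j of n. *)
have step i j n : (i < K)%N -> (s' i <= j <= s i.+1)%N -> (s' i.+1 <= n <= s i.+2)%N ->
    a n <= a j + e / 2.
  move=> iK ji ni.
  have jn : (j <= n)%N by have := ss' i.+1; lia.
  have j0 : (0 < j)%N by have := s0 i; have := ss' i; lia.
  have n0 : (0 < n)%N by exact: leq_trans jn.
  have nK : (n <= s K.+1)%N by have := s_le i.+2 K.+1 iK; lia.
  have := @orbit_mean_near _ _ C b b_gt0 C_bounded T T_C x Cx 'I_j
    (@uniform_weight _ j) (fun i => j + i)%N (e / 4) N0 (G N0) (H N0) (n - j) n n j f (a j).
  rewrite -orbit_meanE => near.
  have : `|S n n - f| <= a j + e / 4 + j%:R * b / n%:R.
    apply: near => //.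
    - exact: uniform_weight_convex.
    - by move=> k; have := ltn_ord k; have := sN i; have := ss' i; rewrite GS; lia.
    - by rewrite HS; lia.
    - by move=> k; have := ltn_ord k; lia.
    - by move=> k; have := ltn_ord k; lia.
    - move=> l _; rewrite -[X in _ - X](iter_fixpoint l).
      by apply: (iter_nonexp T_C T_nonexp) => //; exact: (orbit_mean_C C_convex).
  have : j%:R * b / n%:R <= e / 4.
    apply: div_ceilN_le => //.
    apply: leq_trans (_ : (s' i.+1 <= n)%N); last by have := ni; lia.
    apply: leq_trans (leq_maxr _ _); apply: ceilN_le.
      by rewrite divr_ge0 ?mulr_ge0// ltW.
    have -> : j%:R * b / (e / 4) = 4 * j%:R * b / e by field; rewrite gt_eqF.
    rewrite ler_wpM2r ?invr_ge0 ?(ltW e0)// ler_wpM2r ?(ltW b_gt0)//.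
    by rewrite ler_wpM2l// ler_nat; have := ji; lia.
  rewrite /a; lra.
have [[i iK good]|bad] := pselect (exists2 i, (i <= K)%N &
    forall m n, (s' i <= m <= s' i + g (s' i))%N -> (s' i <= n <= s' i + g (s' i))%N ->
      `|a m - a n| < e).
  exists (s' i); split => //.
  - exact: leq_trans (ss' i).
  - apply: leq_trans (g_iter_mono b_gt0 g (K + 1) e0 N0B).
    rewrite addn1 -/(s _); apply: leq_trans (s_le i.+1 K.+1 iK).
    by have := s'sS i; lia.
  - apply: almost_affine_sub aff _ _ _.
    + exact: leq_trans (ss' i).
    + rewrite GS; have := s'sS i; have := s_le i.+1 K.+1 iK; lia.
    + rewrite HS; apply: leq_trans (leq_maxr _ _); apply: leq_maxf.
      by have := s'sS i; have := s_le i.+1 K.+1 iK; lia.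
have drop i : (i <= K)%N -> exists j j', [/\ (s' i <= j <= s i.+1)%N,
    (s' i <= j' <= s i.+1)%N & a j' <= a j - e].
  move=> iK; apply: contrapT => nex; apply: bad; exists i => // m n mr nr.
  rewrite ltNge; apply/negP => far; apply: nex.
  have mr' : (s' i <= m <= s i.+1)%N by have := s'sS i; lia.
  have nr' : (s' i <= n <= s i.+1)%N by have := s'sS i; lia.
  move: far; rewrite ler_normr => /orP[far|far]; [exists m, n|exists n, m]; split => //; lra.
(* The bound holds on the whole stage, since the point j before the drop is not known in advance. *)
have desc i : (i <= K)%N -> forall n, (s' i <= n <= s i.+1)%N -> a n <= b - i%:R * (e / 2).
  elim: i => [_ n nr|i IH iK n nr].
    rewrite mul0r subr0; apply: (bounded_dist C_bounded) => //.
    apply: (orbit_mean_C C_convex) => //; by have := s0 0%N; have := ss' 0%N; lia.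
  have [j [j' [jr j'r jj']]] := drop i (ltnW iK).
  have := step i j' n iK j'r nr; have := IH (ltnW iK) j jr.
  have -> : i.+1%:R * (e / 2) = i%:R * (e / 2) + e / 2 by rewrite -natr1 mulrDl mul1r.
  lra.
have [j [j' [jr j'r jj']]] := drop K (leqnn K).
have := desc K (leqnn K) j jr.
have : 2 * b / e <= K%:R by exact: ceilN_ge.
rewrite ler_pdivrMr// => Kb.
have : 0 <= a j' by exact: normr_ge0.
lra.
Qed.

Lemma delta_of_gt0 (e : R) : 0 < e -> 0 < delta_of b eta e.
Proof.
move=> e0; rewrite /delta_of !lt_min b_gt0 divr_gt0//= mulr_gt0// ?divr_gt0//.
by rewrite -(eta0 eta_mod); apply: (eta_mono eta_mod) => //; rewrite divr_gt0// mulr_gt0.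
Qed.

Lemma modulus_ball (u v : X) (r e : R) : 0 < r -> 0 < e -> `|u| <= r -> `|v| <= r ->
  e <= `|u - v| -> `|2^-1 *: (u + v)| <= r - r * eta (e / r).
Proof.
move=> r0 e0 ur vr euv.
have scale (y : X) : `|r^-1 *: y| = `|y| / r by rewrite normrZ gtr0_norm ?invr_gt0// mulrC.
have := (let: And4 _ _ H _ := eta_mod in H) (e / r) (r^-1 *: u) (r^-1 *: v).
rewrite -scalerDr -scalerBr scalerA [2^-1 * _]mulrC -scalerA !scale.
rewrite !ler_pdivrMr// mul1r mulrBl mul1r divfK ?gt_eqF// [eta _ * r]mulrC.
by apply=> //; rewrite divr_gt0.
Qed.

(** If the two means were e apart, their midpoint would be at distance at most r - 4 d from f, r
    being the larger of their distances. For large M, S_M T^M x is then within r - 4 d + d / 4 + d /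
    6 of f, against the metastability of these distances, which gives more than r - d. *)
Lemma delta_metastable (e : R) (g h : nat -> nat) : 0 < e ->
  exists N, [/\ (0 < N)%N, (N <= Delta b eta B e g h)%N,
    almost_affine (e / 16) N (g N) (h N) &
    forall m n, (N <= m <= N + g N)%N -> (N <= n <= N + g N)%N ->
      `|S m m - S n n| < e].
Proof.
move=> e0; rewrite /Delta; set d := delta_of b eta e.
have d0 : 0 < d := delta_of_gt0 e0.
pose g' n := ceilN (6 * b * (n + g n)%:R / d).
have [N [N0 NT aff close]] := theta_metastable (fun n => g n + g' n)%N
  (fun n => maxn (n + g n + 2 * g' n) (h n)) d0.
have [de db] : d <= e / 4 /\ d <= e / 8 * eta (e / (2 * b)).
  by rewrite /d /delta_of !ge_min !lexx !orbT.
exists N; split => //.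
  move=> I w p l w_cvx pr lh; apply: le_trans (aff I w p l w_cvx _ _) _; last by lra.
  - by move=> i; have := pr i; lia.
  - by rewrite leq_max lh orbT.
clear NT; set t := g' N in aff close *.
have tE : t = ceilN (6 * b * (N + g N)%:R / d) by [].
clearbody t; clear g'.
move=> m n; wlog anm : m n / `|S n n - f| <= `|S m m - f|.
  move=> W mr nr; have [|/ltW] := leP `|S n n - f| `|S m m - f|; first by move/W; apply.
  by move/W; rewrite distrC; apply.
move=> mr nr.
(* M is the end of the window; p_i + t stays within N + g N of it, and M >= t makes the shift error
   at most d / 6. *)
pose M := (N + (g N + t))%N; have ME : M = (N + (g N + t))%N by [].
clearbody M; have M0 : (0 < M)%N by lia.
have tM : (t <= M)%N by lia.
have mM : (N <= m <= N + (g N + t))%N by lia.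
have MM : (N <= M <= N + (g N + t))%N by lia.
have m0 : (0 < m)%N by lia.
have n0 : (0 < n)%N by lia.
(* The disjoint sum of index sets presents the midpoint as one convex combination of orbit
   points. *)
pose p (i : 'I_m + 'I_n) : nat := match i with inl i => m + i | inr i => n + i end.
have pb i : (N <= p i)%N /\ (p i < 2 * (N + g N))%N.
  by case: i => i /=; have := ltn_ord i; lia.
have pN i : (N <= p i <= 2 * (N + (g N + t)))%N by have := pb i; lia.
have tH : (t + M <= (maxn (N + g N + 2 * t) (h N)).+1)%N by lia.
have pM i : (p i + t <= M + (N + g N))%N by have := pb i; lia.
have Mp i : (M <= p i + t + (N + g N))%N by have := pb i; lia.
rewrite ltNge; apply/negP => far.
have CS j k : (0 < j)%N -> C (S j k) by exact: (orbit_mean_C C_convex).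
set r := `|S m m - f| in anm.
have uv : e <= `|(S m m - f) - (S n n - f)| by rewrite opprB addrA subrK.
have re : e / 2 <= r.
  by have := le_trans uv (ler_normB _ _); rewrite -/r; lra.
have rb : r <= b by apply: (bounded_dist C_bounded) => //; exact: CS.
have r0 : 0 < r by lra.
have mid := modulus_ball r0 e0 (lexx r) anm uv.
(* Uses r >= e / 2 for the factor and r <= 2 b inside eta; the term e / 8 of [delta_of] is a quarter
   of e / 2. *)
have rd : 4 * d <= r * eta (e / r).
  have eb0 : 0 <= e / (2 * b) by rewrite divr_ge0 ?mulr_ge0// ltW.
  have : e / 2 * eta (e / (2 * b)) <= r * eta (e / r).
    apply: ler_pM => //; first by rewrite divr_ge0// ltW.
      exact: (eta_ge0 eta_mod).
    apply: (eta_le eta_mod) => //; rewrite ler_wpM2l ?(ltW e0)//.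
    rewrite lef_pV2 ?posrE ?mulr_gt0//; lra.
  lra.
have := close m M mM MM; rewrite -/r ltr_norml => /andP[_ rM].
pose w (i : 'I_m + 'I_n) : R :=
  match i with inl _ => 2^-1 * m%:R^-1 | inr _ => 2^-1 * n%:R^-1 end.
have w_cvx : convex_weights w.
  split=> [[i|i]|]; rewrite /w ?mulr_ge0 ?invr_ge0//.
  have half k : (0 < k)%N -> \sum_(i < k) (2^-1 / k%:R) = 2^-1 :> R.
    by move=> k0; rewrite sumr_const card_ord -[LHS]mulr_natr divfK// pnatr_eq0 -lt0n.
  by rewrite big_sumType/= !half// [RHS]splitr mul1r.
have UE : \sum_i w i *: iter (p i) T x = 2^-1 *: (S m m + S n n).
  rewrite big_sumType/= scalerDr !orbit_meanE !scaler_sumr.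
  by congr (_ + _); apply: eq_bigr => i _; rewrite scalerA.
have := @orbit_mean_near _ _ C b b_gt0 C_bounded T T_C x Cx _ w p (d / 4) N
  (g N + t)%N _ t M M (N + g N)%N f `|2^-1 *: (S m m + S n n) - f| aff w_cvx M0.
rewrite UE => near.
have {near} : `|S M M - f| <= `|2^-1 *: (S m m + S n n) - f| + d / 4 +
    (N + g N)%:R * b / M%:R.
  apply: near => // l _; rewrite -[X in _ - X](iter_fixpoint l).
  apply: (iter_nonexp T_C T_nonexp) => //; rewrite -UE.
  by apply: convex_set_sum => // i; exact: (iter_stable T_C).
have -> : 2^-1 *: (S m m + S n n) - f = 2^-1 *: ((S m m - f) + (S n n - f)).
  rewrite addrACA -opprD scalerBr; congr (_ - _).
  rewrite scalerDr -scalerDl; have -> : 2^-1 + 2^-1 = 1 :> R by field.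
  by rewrite scale1r.
have : (N + g N)%:R * b / M%:R <= d / 6.
  apply: div_ceilN_le => //; first by rewrite divr_gt0.
  have -> : (N + g N)%:R * b / (d / 6) = 6 * b * (N + g N)%:R / d by field; rewrite gt_eqF.
  by rewrite -tE.
lra.
Qed.

(** For the last claim S_n T^n x is exchanged for S_n' T^n' x with n' so large that a shift by l is
    negligible: three errors of e / 4 and one of e / 64. *)
Lemma psi_metastable (e : R) (g h : nat -> nat) : 0 < e ->
  exists N, [/\ (0 < N)%N, (N <= Psi b eta B e g h)%N,
    almost_affine (e / 64) N (g N) (h N),
    forall m n, (N <= m <= N + g N)%N -> (N <= n <= N + g N)%N ->
      `|S m m - S n n| < e / 4 &
    forall n l, (N <= n <= N + g N)%N -> (l <= h N)%N ->
      `|iter l T (S n n) - S n n| < e].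
Proof.
move=> e0; have e40 : 0 < e / 4 by rewrite divr_gt0.
have [N [N0 NP aff close]] := delta_metastable
  (fun N => maxn (g N) (ceilN (4 * b * (h N)%:R / e))) h e40.
have e64 : e / 4 / 16 = e / 64 by field.
rewrite e64 in aff.
exists N; split => //.
- by apply: almost_affine_sub aff _ _ _ => //; rewrite leq_add2l leq_maxl.
- by move=> m n mr nr; apply: close; lia.
move=> n l nr lh; set t := ceilN _ in aff close.
pose n' := (N + t)%N.
have n'0 : (0 < n')%N by rewrite /n'; lia.
have n0 : (0 < n)%N by lia.
have n'r : (N <= n' <= N + maxn (g N) t)%N by rewrite /n'; lia.
have nn' : `|S n n - S n' n'| < e / 4 by apply: close => //; lia.
have CS j k : (0 < j)%N -> C (S j k) by exact: (orbit_mean_C C_convex).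
have h1 : `|iter l T (S n n) - iter l T (S n' n')| <= `|S n n - S n' n'|.
  by apply: (iter_nonexp T_C T_nonexp); exact: CS.
have h2 := almost_affine_orbit_mean aff n'0 n'r lh.
have h3 : `|S n' (n' + l) - S n' n'| <= e / 4.
  apply: le_trans (orbit_mean_shift C_bounded T_C Cx _ _ n'0) _.
  apply: div_ceilN_le => //; apply: leq_trans (_ : (t <= n')%N); last by rewrite /n'; lia.
  apply: ceilN_le; first by rewrite divr_ge0 ?mulr_ge0// ltW.
  have -> : l%:R * b / (e / 4) = 4 * b * l%:R / e by field; rewrite gt_eqF.
  by rewrite ler_wpM2r ?invr_ge0 ?(ltW e0)// ler_wpM2l ?mulr_ge0 ?(ltW b_gt0)// ler_nat.
have h4 := ler_distD (iter l T (S n' n')) (iter l T (S n n)) (S n n).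
have h5 := ler_distD (S n' (n' + l)) (iter l T (S n' n')) (S n n).
have h6 := ler_distD (S n' n') (S n' (n' + l)) (S n n).
rewrite [`|S n' n' - S n n|]distrC in h6.
lra.
Qed.

(** All means are compared with S_P T^P x, where P is the stage found for e / 2. *)
Lemma phi_metastable (e : R) (g h : nat -> nat) : 0 < e ->
  exists N, [/\ (0 < N)%N, (N <= Phi b eta B e g h)%N,
    forall m n k, (N <= m <= N + g N)%N -> (N <= n <= N + g N)%N -> (k <= h N)%N ->
      `|S m m - S n k| < e &
    forall n l, (N <= n <= N + g N)%N -> (l <= h N)%N ->
      `|iter l T (S n n) - S n n| < e / 2].
Proof.
move=> e0; have e20 : 0 < e / 2 by rewrite divr_gt0.
rewrite /Phi; set g' := fun n => (N_of b e n + _)%N; set h' := fun n => (g' n + _)%N.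
have [P [P0 PP aff close fixed]] := psi_metastable g' h' e20.
set N := N_of b e P.
have PN : (P <= N)%N by exact: leq_maxl.
have g'E : g' P = (N + g N)%N by [].
have h'E : h' P = (N + g N + h N)%N by [].
exists N; split => //.
- exact: leq_trans PN.
- exact: N_of_mono.
- move=> m n k mr nr kh.
  have n0 : (0 < n)%N by lia.
  have := @orbit_mean_near _ _ C b b_gt0 C_bounded T T_C x Cx 'I_P
    (@uniform_weight _ P) (fun i => P + i)%N (e / 2 / 64) P (g' P) (h' P) k n k (2 * P)
    (S P P) (e / 2).
  rewrite -orbit_meanE => near.
  (* The starting points P + i + k with i < P lie within 2 P of k, and n >= 6 P b / e makes this
     shift cost e / 3. With e / 8 for S_m T^m x the total e / 2 + e / 128 + e / 3 + e / 8 is below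
     e. *)
  have {near} : `|S n k - S P P| <= e / 2 + e / 2 / 64 + (2 * P)%:R * b / n%:R.
    apply: near => //.
    - exact: uniform_weight_convex.
    - by move=> i; have := ltn_ord i; rewrite g'E; lia.
    - by rewrite h'E; lia.
    - by move=> i; have := ltn_ord i; lia.
    - by move=> i; have := ltn_ord i; lia.
    - by move=> l lr; apply/ltW/fixed; rewrite ?h'E ?g'E; lia.
  have : (2 * P)%:R * b / n%:R <= e / 3.
    apply: div_ceilN_le => //; first by rewrite divr_gt0.
    apply: leq_trans (_ : (N <= n)%N); last by lia.
    apply: leq_trans (leq_maxr _ _).
    have -> : (2 * P)%:R * b / (e / 3) = 6 * P%:R * b / e.
      by rewrite natrM; field; rewrite gt_eqF.
    exact: leqnn.
  have : `|S m m - S P P| < e / 2 / 4 by apply: close; rewrite ?g'E; lia.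
  have := ler_distD (S P P) (S m m) (S n k).
  rewrite [`|S P P - S n k|]distrC; lra.
- by move=> n l nr lh; apply: fixed; rewrite ?g'E ?h'E; lia.
Qed.

End Metastability.

(** * The three estimates combined *)

Theorem corollary4p13 (R : realType) (X : completeNormedModType R)
    (X_uc : uniformly_convex X)
    (C : set X) (C_neq0 : C !=set0) (C_closed : closed C)
    (C_convex : convex_set C)
    (b : R) (b_gt0 : 0 < b) (C_bounded : forall y, C y -> `|y| <= b / 2)
    (T : X -> X) (T_C : forall y, C y -> C (T y))
    (T_nonexp : forall y z, C y -> C z -> `|T y - T z| <= `|y - z|)
    (T_fix : exists2 y, C y & T y = y)
    (eta : R -> R) (eta_mod : convexity_modulus X eta)
    (c q : R) (c_gt0 : 0 < c) (q_gt1 : 1 < q)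
    (cq_type : type_inequality X c q)
    (x : X) (Cx : C x)
    (A : functional R) (A_rate : metastability_rate T x A)
    (eps : R) (eps_gt0 : 0 < eps) (g h : nat -> nat) :
  exists N : nat,
    [/\ (0 < N)%N,
        (N <= Phi b eta (B_of b c q eta A) (2 * eps / 5) g h)%N &
        forall m n k l : nat,
          (N <= m <= N + g N)%N -> (N <= n <= N + g N)%N ->
          (k <= h N)%N -> (l <= h N)%N ->
          let Skn := ergodic_mean T n (iter k T x) in
          let Snn := ergodic_mean T n (iter n T x) in
          Num.max
            (Num.max `|ergodic_mean T m (iter m T x) - Skn|
                     `|iter l T Snn - Snn|)
            `|iter l T Skn - Skn| < eps].
Proof.
case: T_fix => f Cf Tf; have e0 : 0 < 2 * eps / 5 by rewrite divr_gt0 ?mulr_gt0.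
have [N [N0 NP close fixed]] := phi_metastable C_convex b_gt0 C_bounded eta_mod
  c_gt0 q_gt1 cq_type T_C T_nonexp Cf Tf Cx A_rate g h e0.
exists N; split => // m n k l mr nr kh lh /=.
set Skn := ergodic_mean T n (iter k T x); set Snn := ergodic_mean T n (iter n T x).
have n0 : (0 < n)%N by move: nr => /andP[/(leq_trans N0)].
have mk := close m n k mr nr kh; have nk := close n n k nr nr kh.
have ln := fixed n l nr lh.
rewrite /orbit_mean -/Skn -/Snn in mk nk ln.
have lk : `|iter l T Skn - iter l T Snn| <= `|Skn - Snn|.
  by apply: (iter_nonexp T_C T_nonexp); exact: (orbit_mean_C C_convex T_C Cx).
(* With e = 2 eps / 5 the path through T^l S_n T^n x and S_n T^n x costs less than e + e / 2 + e =
   eps. *)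
have h1 := ler_distD (iter l T Snn) (iter l T Skn) Skn.
have h2 := ler_distD Snn (iter l T Snn) Skn.
rewrite [`|Skn - Snn|]distrC in lk.
by rewrite !gt_max; apply/andP; split; [apply/andP; split|]; lra.
Qed.
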